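(* Let $G$ be a nonsingular finite simple graph of order $n$ with $m$ edges. Then $$\mathcal E(G)\ge\frac{M_1(G)}{m}\qquad\text{and}\qquad \mathcal E(G)\ge\frac{M_1(G)}{2m}+\frac{2m}{n}.$$ Equality in either inequality holds if and only if $G\cong K_n$.
   Context: For a finite simple graph $G$ with vertex set $V(G)$, $|V(G)|=n$, let $A(G)$ be its adjacency matrix with eigenvalues $\lambda_1\ge\cdots\ge\lambda_n$. The energy is $\mathcal E(G)=\sum_{i=1}^n|\lambda_i|$. $G$ is nonsingular if $A(G)$ is nonsingular. The first Zagreb index is $M_1(G)=\sum_{v\in V(G)}d_v^2$, where $d_v$ is the degree of $v$. $K_n$ is the complete graph on $n$ vertices. *)

(* Defs.v *)
From HB Require Import structures.
From mathcomp Require Import all_boot all_order all_algebra.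
From mathcomp Require Import complex.
From mathcomp Require Import reals.

Set Implicit Arguments.
Unset Strict Implicit.
Unset Printing Implicit Defensive.

Import Order.TTheory GRing.Theory Num.Theory.

Record sgraph := SGraph {
  vertex :> finType;
  adj : rel vertex;
  adj_sym : symmetric adj;
  adj_irrefl : irreflexive adj
}.

Section Graph.
Variable G : sgraph.

Definition deg (v : G) : nat := #|[set w | adj v w]|.

Definition edges : {set {set G}} :=
  [set [set p.1; p.2] | p : G * G & adj p.1 p.2].

Definition zagreb1 : nat := \sum_(v : G) deg v ^ 2.

End Graph.

Definition isomorphic (G H : sgraph) : Prop :=
  exists2 f : G -> H, bijective f & forall x y, adj (f x) (f y) = adj x y.

Section Complete.
Variable n : nat.

Let neq (i j : 'I_n) := i != j.

Lemma complete_sym : symmetric neq.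
Proof. by move=> i j; rewrite /neq eq_sym. Qed.

Lemma complete_irrefl : irreflexive neq.
Proof. by move=> i; rewrite /neq eqxx. Qed.

Definition complete : sgraph := SGraph complete_sym complete_irrefl.

End Complete.

Local Open Scope ring_scope.

Section Spectrum.
Variable R : realType.

Lemma sym_char_poly_split (n : nat) (A : 'M[R]_n) : A^T = A ->
  exists s : n.-tuple R,
    sorted >=%R s && (char_poly A == \prod_(x <- s) ('X - x%:P)).
Proof.
move=> Asym; pose f : {rmorphism R -> R[i]} := real_complex R.
pose B := map_mx f A.
have B_herm : B \is hermsymmx.
  apply: realsym_hermsym.
    by apply/is_hermitianmxP; rewrite expr0 scale1r map_mx_id // /B map_trmx Asym.
  by apply/mxOverP => i j; rewrite mxE complex_real.
have /hermitian_normalmx/orthomx_spectralP B_eq := B_herm.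
set P := spectralmx B in B_eq; set d := spectral_diag B in B_eq.
have d_real := hermitian_spectral_diag_real B_herm.
pose t := [seq complex.Re (d 0 i) | i : 'I_n].
have t_size : size (sort >=%R t) == n by rewrite size_sort size_image card_ord.
exists (Tuple t_size); apply/andP; split=> /=.
  by apply: sort_sorted => x y; apply: le_total.
have P_unit : P \in unitmx by apply: spectral_unit.
apply/eqP/(map_poly_inj f); rewrite map_char_poly -/B rmorph_prod /=.
have -> : char_poly B = char_poly (diag_mx d).
  pose Q := map_mx polyC P; have Q_unit : Q \in unitmx.
    by rewrite unitmxE det_map_mx rmorph_unit // -unitmxE.
  rewrite B_eq /char_poly.
  have -> : char_poly_mx (invmx P *m diag_mx d *m P) =
            invmx Q *m char_poly_mx (diag_mx d) *m Q.
    rewrite /char_poly_mx mulmxBr mulmxBl !map_mxM map_invmx -/Q.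
    by rewrite scalar_mxC -[_ *m invmx Q *m Q]mulmxA mulVmx // mulmx1.
  by rewrite !det_mulmx mulrAC -det_mulmx mulVmx // det1 mul1r.
rewrite char_poly_trig ?diag_mx_is_trig //.
rewrite (perm_big _ (permEl (perm_sort _ _))) /= big_image /=.
apply: eq_bigr => i _; rewrite rmorphB /= map_polyX map_polyC /=.
by rewrite RRe_real ?(mxOverP d_real) // mxE eqxx mulr1n.
Qed.

Variable G : sgraph.

Definition adjmx : 'M[R]_#|G| :=
  \matrix_(i, j) (adj (enum_val i) (enum_val j))%:R.

Lemma adjmx_sym : adjmx^T = adjmx.
Proof. by apply/matrixP => i j; rewrite !mxE adj_sym. Qed.

(* The nonincreasing list of eigenvalues, repeated according to multiplicity;
   it is determined by the property [eigenvaluesP]. *)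
Definition eigenvalues : #|G|.-tuple R := xchoose (sym_char_poly_split adjmx_sym).

Lemma eigenvaluesP : sorted >=%R eigenvalues /\
  char_poly adjmx = \prod_(x <- eigenvalues) ('X - x%:P).
Proof.
by have /andP[? /eqP] := xchooseP (sym_char_poly_split adjmx_sym).
Qed.

Definition energy : R := \sum_(i < #|G|) `|tnth eigenvalues i|.

Definition nonsingular : bool := adjmx \in unitmx.

End Spectrum.

(* Main.v *)
Require Import Defs.
From mathcomp Require Import all_boot all_order all_algebra.
From mathcomp Require Import reals sequences exp.
From mathcomp Require Import ring lra.

(* Write N = n - 1, S1 = sum of the degrees = 2m, S2 = M_1, and let
   l >= y >= ... >= -t be the eigenvalues. The second bound follows from the
   first by Cauchy-Schwarz, S1^2 <= n S2, so it suffices to show E > 2 S2 / S1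
   when G is nonsingular and not complete. Assume E <= 2 D with D = S2 / S1.
   - Nonadjacent vertices have distinct neighbourhoods and there are no isolated
     vertices, so G contains an induced 2K_2, P_4 or paw; hence y >= 31/100.
     As the trace is 0, E >= 2 (l + y), so D - l >= y.
   - (A - l)(A + t) <= 0 on the all-ones vector gives
     S2 <= (l - t) S1 + l t n.
   - De Caen's inequality gives 2 N S2 <= S1^2 + N (N - 1) S1.
   - The determinant is a nonzero integer, so the product of the |lambda_i| is
     at least 1; z <= exp (z - 1) on all factors except l, y and t gives
     1 <= l t y exp (2 D - l - t - y - (n - 3)).
   Eliminating N, S1, S2 and l leaves
   1 <= t (t + y) exp (1 - y - t - 2 y / (t + 2 y)), which is false for
   y >= 31/100. *)

Set Implicit Arguments.
Unset Strict Implicit.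
Unset Printing Implicit Defensive.

Import Order.TTheory GRing.Theory Num.Theory.
Local Open Scope ring_scope.

(** * The real spectral theorem *)

Lemma mulmx_tr_scalar (R : comNzRingType) (n : nat) (u : 'rV[R]_n) :
  u *m u^T = (\sum_i u 0 i ^+ 2)%:M.
Proof.
rewrite [LHS]mx11_scalar mxE; congr (_%:M).
by apply: eq_bigr => i _; rewrite mxE expr2.
Qed.

Lemma sum_sqr_eq0 (R : realFieldType) (n : nat) (u : 'rV[R]_n) :
  (\sum_i u 0 i ^+ 2 == 0) = (u == 0).
Proof.
rewrite psumr_eq0 => [|i _]; last exact: sqr_ge0.
apply/allP/eqP => [u0|-> i _]; last by rewrite mxE expr0n /= eqxx.
apply/rowP => i; rewrite mxE; apply/eqP; rewrite -sqrf_eq0.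
exact: (implyP (u0 i (mem_index_enum i))).
Qed.

(** The reflection in the hyperplane orthogonal to [u - e], with [e] the first basis vector,
    exchanges these two unit vectors; if [u = e] the identity serves. *)
Lemma householder (R : realFieldType) (n : nat) (u : 'rV[R]_n.+1) :
  u *m u^T = 1%:M ->
  exists H : 'M[R]_n.+1, [/\ H^T = H, H *m H = 1%:M & delta_mx 0 0 *m H = u].
Proof.
move=> u1; pose e : 'rV[R]_n.+1 := delta_mx 0 0; pose w := u - e.
have ee : e *m e^T = 1%:M.
  by rewrite /e trmx_delta mul_delta_mx [LHS]mx11_scalar mxE !eqxx.
have ew : e *m w^T = (u 0 0 - 1)%:M.
  rewrite linearB mulmxBr ee /e -rowE [row _ _]mx11_scalar !mxE.
  by rewrite -raddfB.
have [w0|w_neq0] := eqVneq w 0.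
  exists 1%:M; rewrite trmx1 !mulmx1; split=> //.
  by apply/eqP; rewrite eq_sym -subr_eq0 -/e -/w w0.
pose q : R := \sum_i w 0 i ^+ 2.
have q_neq0 : q != 0 by rewrite sum_sqr_eq0.
have ww : w *m w^T = q%:M by apply: mulmx_tr_scalar.
have ue : u *m e^T = (u 0 0)%:M.
  have := congr1 trmx ew; rewrite trmx_mul trmxK tr_scalar_mx mulmxBl ee.
  by move=> /eqP; rewrite subr_eq -raddfD subrK => /eqP.
have eu : e *m u^T = (u 0 0)%:M.
  by have := congr1 trmx ue; rewrite trmx_mul trmxK tr_scalar_mx.
have qE : q = 2 * (1 - u 0 0).
  have : q%:M = (2 * (1 - u 0 0))%:M :> 'M[R]_1.
    rewrite -ww /w linearB mulmxBl !mulmxBr u1 ee ue eu -!raddfB.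
    by congr (_%:M); ring.
  by move/matrixP/(_ 0 0); rewrite !mxE !mulr1n.
have [P [PT PP eP]] : exists P : 'M[R]_n.+1,
    [/\ P^T = P, P *m P = q *: P & e *m P = (u 0 0 - 1) *: w].
  exists (w^T *m w); split; first by rewrite trmx_mul trmxK.
    by rewrite -mulmxA [w *m (_ *m _)]mulmxA ww mul_scalar_mx -scalemxAr.
  by rewrite mulmxA ew mul_scalar_mx.
exists (1%:M - (2 / q) *: P); split.
- by rewrite linearB /= trmx1 linearZ /= PT.
- rewrite mulmxBl mul1mx mulmxBr mulmx1 -scalemxAl -scalemxAr PP !scalerA.
  rewrite [2 / q * (2 / q) * q](_ : _ = 2 / q + 2 / q); last by field.
  by rewrite scalerDl opprB addrK subrK.
- rewrite -/e mulmxBr mulmx1 -scalemxAr eP scalerA.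
  rewrite [2 / q * _](_ : _ = -1); last first.
    have h : 1 - u 0 0 != 0.
      by apply: contraNneq q_neq0 => h; rewrite qE h mulr0.
    by rewrite qE; field.
  by rewrite scaleN1r opprK addrC subrK.
Qed.

Lemma char_poly_similar (R : fieldType) (n : nat) (A P : 'M[R]_n) :
  P \in unitmx -> char_poly (invmx P *m A *m P) = char_poly A.
Proof.
move=> P_unit; pose Q := map_mx polyC P.
have Q_unit : Q \in unitmx.
  by rewrite unitmxE det_map_mx rmorph_unit // -unitmxE.
have -> : char_poly (invmx P *m A *m P) =
    \det (invmx Q *m char_poly_mx A *m Q).
  rewrite /char_poly /char_poly_mx mulmxBr mulmxBl !map_mxM map_invmx -/Q.
  by rewrite scalar_mxC -[_ *m invmx Q *m Q]mulmxA mulVmx // mulmx1.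
by rewrite !det_mulmx mulrAC -det_mulmx mulVmx // det1 mul1r.
Qed.

Lemma char_poly_block_diag (R : comNzRingType) (m n : nat)
    (A : 'M[R]_m) (B : 'M[R]_n) :
  char_poly (block_mx A 0 0 B) = char_poly A * char_poly B.
Proof.
rewrite /char_poly /char_poly_mx map_block_mx !raddf0 scalar_mx_block.
by rewrite opp_block_mx add_block_mx !oppr0 !addr0 det_ublock.
Qed.

(** Deflation by induction: a reflection moves a unit eigenvector for the head [x] to the first
    basis vector, and symmetry splits off a block whose spectrum is the tail. The order of [s] is
    kept, so for a sorted list index 0 carries the largest eigenvalue. *)
Lemma sym_spectral (R : rcfType) (n : nat) (A : 'M[R]_n) (s : seq R) :
    A^T = A -> size s = n -> char_poly A = \prod_(x <- s) ('X - x%:P) ->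
  exists2 U : 'M[R]_n, U *m U^T = 1%:M &
    A = U^T *m diag_mx (\row_i s`_i) *m U.
Proof.
elim: n A s => [|n IHn] A [|x s] // A_sym.
  by exists 1%:M; rewrite ?[LHS]thinmx0 //; apply/matrixP=> [[]].
move=> [s_size] A_char.
have /eigenvalueP[v vA v_neq0] : eigenvalue A x.
  by rewrite eigenvalue_root_char A_char root_prod_XsubC mem_head.
pose q : R := \sum_i v 0 i ^+ 2.
have q_gt0 : 0 < q.
  rewrite lt_neqAle eq_sym sum_sqr_eq0 v_neq0 /=.
  by apply: sumr_ge0 => i _; apply: sqr_ge0.
pose u := (Num.sqrt q)^-1 *: v.
have u1 : u *m u^T = 1%:M.
  rewrite /u linearZ /= -scalemxAr -scalemxAl mulmx_tr_scalar -/q.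
  rewrite scalerA -expr2 exprVn sqr_sqrtr ?ltW // -mul_scalar_mx -scalar_mxM.
  by rewrite mulVf ?gt_eqF.
have uA : u *m A = x *: u by rewrite /u -scalemxAl vA !scalerA mulrC.
have [H [H_sym HH eH]] := householder u1.
have uH : u *m H = delta_mx 0 0 by rewrite -eH -mulmxA HH mulmx1.
have [A' A'_def] : exists A' : 'M[R]_(1 + n), A' = H *m A *m H by exists (H *m A *m H).
have A'_sym : A'^T = A' by rewrite A'_def !trmx_mul H_sym A_sym mulmxA.
have A'_row : row 0 A' = x *: delta_mx 0 0.
  by rewrite rowE A'_def !mulmxA eH uA -scalemxAl uH.
pose B := drsubmx A'.
have A'E : A' = block_mx x%:M 0 0 B.
  have ur0 : ursubmx A' = 0.
    apply/matrixP=> i j; rewrite !mxE ord1.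
    have := congr1 (fun r : 'rV_n.+1 => r 0 (rshift 1 j)) A'_row.
    by rewrite !mxE /= mulr0 => <-; congr (A' _ _); apply/val_inj.
  have dl0 : dlsubmx A' = 0 by rewrite -A'_sym -trmx_ursub ur0 trmx0.
  rewrite -[LHS]submxK ur0 dl0; congr (block_mx _ _ _ _).
  rewrite [LHS]mx11_scalar !mxE.
  have := congr1 (fun r : 'rV_n.+1 => r 0 0) A'_row.
  rewrite !mxE !eqxx /= mulr1 => <-.
  by congr (A' _ _)%:M; apply/val_inj.
have B_sym : B^T = B by rewrite /B trmx_drsub A'_sym.
have H_unit : H \in unitmx by case/mulmx1_unit: HH.
have A'_char : char_poly A' = char_poly A.
  suff -> : A' = invmx H *m A *m H by apply: char_poly_similar.
  by rewrite A'_def -[invmx H]mulmx1 -HH mulKmx.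
have B_char : char_poly B = \prod_(y <- s) ('X - y%:P).
  have X_neq0 : 'X - x%:P != 0 by rewrite polyXsubC_eq0.
  apply: (mulfI X_neq0); rewrite -(big_cons _ _ x s xpredT (fun y => 'X - y%:P)).
  rewrite -A_char -A'_char A'E.
  rewrite char_poly_block_diag; congr (_ * _).
  by rewrite char_poly_trig ?scalar_mx_is_trig // big_ord1 mxE mulr1n.
have [V VV BE] := IHn B s B_sym s_size B_char.
pose W : 'M[R]_(1 + n) := block_mx 1%:M 0 0 V.
have WW : W *m W^T = 1%:M.
  rewrite /W tr_block_mx !trmx0 mulmx_block !mulmx0 !mul0mx !addr0 !add0r.
  by rewrite trmx1 mulmx1 VV -scalar_mx_block.
exists (W *m H).
  by rewrite trmx_mul H_sym -mulmxA [H *m (H *m _)]mulmxA HH mul1mx.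
have -> : diag_mx (\row_i (x :: s)`_i) =
    block_mx x%:M 0 0 (diag_mx (\row_i s`_i)) :> 'M[R]_(1 + n).
  have -> : \row_i (x :: s)`_i = row_mx x%:M (\row_i s`_i) :> 'rV[R]_(1 + n).
    apply/rowP=> j; rewrite !mxE; case: splitP => k jk; rewrite !mxE jk.
      by rewrite !ord1 mulr1n.
    by [].
  rewrite diag_mx_row; congr (block_mx _ _ _ _).
  by apply/matrixP=> i j; rewrite !mxE !ord1 !eqxx.
have A'_spec : A' = W^T *m block_mx x%:M 0 0 (diag_mx (\row_i s`_i)) *m W.
  rewrite A'E BE /W tr_block_mx !mulmx_block !trmx0 trmx1.
  by rewrite !(mulmx0, mul0mx, addr0, add0r, mul1mx, mulmx1).
have -> : A = H *m A' *m H.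
  by rewrite A'_def !mulmxA HH mul1mx -mulmxA HH mulmx1.
by rewrite A'_spec trmx_mul H_sym !mulmxA.
Qed.

(** * Consequences of an orthogonal diagonalisation *)

Section SpectralConsequences.
Variables (R : realFieldType) (n : nat) (A U : 'M[R]_n) (s : seq R).
Hypothesis UU : U *m U^T = 1%:M.
Hypothesis AE : A = U^T *m diag_mx (\row_i s`_i) *m U.

Lemma spectral_trace : \tr A = \sum_(i < n) s`_i.
Proof.
rewrite AE mxtrace_mulC mulmxA UU mul1mx mxtrace_diag.
by apply: eq_bigr => i _; rewrite mxE.
Qed.

Lemma spectral_det : \det A = \prod_(i < n) s`_i.
Proof.
rewrite AE det_mulmx mulrC -det_mulmx mulmxA UU mul1mx det_diag.
by apply: eq_bigr => i _; rewrite mxE.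
Qed.

Lemma spectral_diag_entry (i : 'I_n) : (U *m A *m U^T) i i = s`_i.
Proof.
rewrite AE !mulmxA UU mul1mx -mulmxA UU mulmx1.
by rewrite !mxE eqxx mulr1n.
Qed.

(** Used for [K_n], whose adjacency matrix satisfies such an equation. *)
Lemma spectral_quadratic (i : 'I_n) (a b : R) :
  A *m A = a *: A + b%:M -> s`_i ^+ 2 = a * s`_i + b.
Proof.
move=> AA.
have : (U *m (A *m A) *m U^T) i i = s`_i ^+ 2.
  rewrite AE !mulmxA UU mul1mx -!mulmxA UU mulmx1 [U *m (U^T *m _)]mulmxA UU.
  by rewrite mul1mx mul_diag_mx !mxE eqxx mulr1n expr2.
move=> <-; rewrite AA mulmxDr mulmxDl -scalemxAr -scalemxAl mul_mx_scalar.
rewrite -scalemxAl UU [LHS]mxE [X in X + _]mxE [X in _ + X]mxE.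
by rewrite spectral_diag_entry mxE eqxx mulr1.
Qed.

Lemma spectral_sqnorm (v : 'rV[R]_n) :
  \sum_i v 0 i ^+ 2 = \sum_i (v *m U^T) 0 i ^+ 2.
Proof.
have : v *m v^T = (v *m U^T) *m (v *m U^T)^T.
  rewrite trmx_mul trmxK mulmxA -[v *m _ *m U]mulmxA.
  by have /mulmx1C -> := UU; rewrite mulmx1.
by rewrite !mulmx_tr_scalar => /matrixP/(_ 0 0); rewrite !mxE !mulr1n.
Qed.

Lemma spectral_form (v : 'rV[R]_n) :
  (v *m A *m v^T) 0 0 = \sum_(i < n) s`_i * (v *m U^T) 0 i ^+ 2.
Proof.
have -> : v *m A *m v^T =
    v *m U^T *m diag_mx (\row_i s`_i) *m (v *m U^T)^T.
  by rewrite AE trmx_mul trmxK !mulmxA.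
rewrite mul_mx_diag mxE; apply: eq_bigr => i _; rewrite !mxE.
by rewrite -[in RHS]/(_ ^+ 2); ring.
Qed.

Lemma spectral_sqnorm_image (v : 'rV[R]_n) :
  \sum_i (v *m A) 0 i ^+ 2 = \sum_(i < n) s`_i ^+ 2 * (v *m U^T) 0 i ^+ 2.
Proof.
rewrite spectral_sqnorm; apply: eq_bigr => i _.
have -> : v *m A *m U^T = v *m U^T *m diag_mx (\row_i s`_i).
  by rewrite AE !mulmxA -[_ *m U *m U^T]mulmxA UU mulmx1.
by rewrite mul_mx_diag !mxE exprMn mulrC.
Qed.

(** In the eigenbasis this is [(x + t) * (l - x) >= 0] for every eigenvalue [x], weighted by the
    squared coordinates of [v]. *)
Lemma spectral_interval (l t : R) (v : 'rV[R]_n) :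
    (forall i : 'I_n, - t <= s`_i <= l) ->
  \sum_i (v *m A) 0 i ^+ 2 <=
    (l - t) * (v *m A *m v^T) 0 0 + l * t * \sum_i v 0 i ^+ 2.
Proof.
move=> s_itv; rewrite spectral_sqnorm_image spectral_form spectral_sqnorm.
rewrite !mulr_sumr -big_split /=; apply: ler_sum => i _.
have := sqr_ge0 ((v *m U^T) 0 i); move: (_ ^+ 2) => w w_ge0.
rewrite !mulrA -mulrDl; apply: ler_wpM2r => //.
have /andP[h1 h2] := s_itv i.
have : 0 <= (s`_i + t) * (l - s`_i) by apply: mulr_ge0; lra.
rewrite expr2; lra.
Qed.

(** Some nonzero combination of [u1] and [u2] has no component along eigenvector [i0]; on it the
    quadratic form is at most [m] and at least [c] times the squared norm. *)
Lemma courant_fischer_second (i0 : 'I_n) (c m : R) (u1 u2 : 'rV[R]_n) :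
    (forall i : 'I_n, i != i0 -> s`_i <= m) ->
    (forall a b, a *: u1 + b *: u2 = 0 -> a = 0 /\ b = 0) ->
    (forall a b, let v := a *: u1 + b *: u2 in
       c * (\sum_i v 0 i ^+ 2) <= (v *m A *m v^T) 0 0) ->
  c <= m.
Proof.
move=> s_le free form_ge.
pose z (u : 'rV[R]_n) := (u *m U^T) 0 i0.
have [a [b [ab0 zv]]] : exists a b, ~ (a = 0 /\ b = 0) /\ a * z u1 + b * z u2 = 0.
  have [z0|z_neq0] := eqVneq (z u1) 0.
    exists 1, 0; rewrite z0 mulr0 mul0r addr0; split=> //.
    by case=> /eqP; rewrite oner_eq0.
  exists (z u2), (- z u1); split; last by ring.
  by case=> _ /eqP; rewrite oppr_eq0 (negPf z_neq0).
have := form_ge a b; set v := _ + _ => /= v_form.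
have vz : (v *m U^T) 0 i0 = 0.
  by rewrite /v mulmxDl -!scalemxAl mxE [X in X + _]mxE [X in _ + X]mxE.
have v_gt0 : 0 < \sum_i v 0 i ^+ 2.
  rewrite lt_neqAle sumr_ge0 => [|i _]; last exact: sqr_ge0.
  rewrite andbT eq_sym sum_sqr_eq0; apply/eqP => v0.
  exact/ab0/free.
rewrite -(ler_pM2r v_gt0); apply: le_trans v_form _.
rewrite spectral_form spectral_sqnorm mulr_sumr; apply: ler_sum => i _.
have [->|i_neq] := eqVneq i i0; first by rewrite vz expr0n /= !mulr0.
by apply: ler_wpM2r; [apply: sqr_ge0 | apply: s_le].
Qed.

End SpectralConsequences.

(** * Degree sums *)

(** Double counting of ordered adjacent pairs: [h] maps them onto the edges, two to one. *)
Lemma sum_deg (G : sgraph) : (\sum_(v : G) deg v = 2 * #|edges G|)%N.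
Proof.
pose P := [set p : G * G | adj p.1 p.2].
pose h (p : G * G) : {set G} := [set p.1; p.2].
have -> : (\sum_(v : G) deg v = #|P|)%N.
  rewrite -sum1_card (eq_bigl (fun p : G * G => true && adj p.1 p.2)); last first.
    by move=> p; rewrite inE.
  rewrite -(pair_big_dep xpredT (fun v w : G => adj v w) (fun _ _ => 1%N)) /=.
  by apply: eq_bigr => v _; rewrite sum1_card /deg cardsE.
have -> : edges G = h @: P by apply/setP => e; apply/imsetP/imsetP => -[p];
  rewrite !inE => hp ->; exists p; rewrite ?inE.
rewrite -sum1_card (partition_big_imset h) /= mulnC -sum_nat_const.
apply: eq_bigr => e /imsetP[[u v]]; rewrite inE /= => uv ->.
have u_neq_v : u != v by apply: contraTneq uv => ->; rewrite adj_irrefl.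
rewrite sum1_card (_ : #|_| = #|[set (u, v); (v, u)]|).
  by rewrite cards2 xpair_eqE (negPf u_neq_v).
apply: eq_card => -[a b]; rewrite !inE /= /h /= !xpair_eqE; apply/andP/orP.
  case=> ab /eqP eq_ab.
  have : a \in [set u; v] by rewrite -eq_ab !inE eqxx.
  have : b \in [set u; v] by rewrite -eq_ab !inE eqxx orbT.
  have a_neq_b : a != b by apply: contraTneq ab => ->; rewrite inE /= adj_irrefl.
  rewrite !inE => /orP[] /eqP eb /orP[] /eqP ea; rewrite ea eb ?eqxx in a_neq_b *;
    by [left | right].
case=> /andP[/eqP-> /eqP->]; rewrite inE /=; first by rewrite uv eqxx.
by rewrite adj_sym uv setUC eqxx.
Qed.

Section DegreeSums.
Variables (R : realFieldType) (G : sgraph).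
Implicit Types v w : G.

Lemma sum_adj v : \sum_w (adj v w)%:R = (deg v)%:R :> R.
Proof. by rewrite -natr_sum -big_mkcond sum1_card /deg cardsE. Qed.

Lemma zagreb1E : (zagreb1 G)%:R = \sum_(v : G) (deg v)%:R ^+ 2 :> R.
Proof. by rewrite natr_sum; apply: eq_bigr => v _; rewrite natrX. Qed.

Lemma sum_adj_deg :
  \sum_(v : G) \sum_w (adj v w)%:R * (deg w)%:R = (zagreb1 G)%:R :> R.
Proof.
rewrite zagreb1E exchange_big; apply: eq_bigr => w _.
rewrite -mulr_suml expr2 -sum_adj; congr (_ * _).
by apply: eq_bigr => v _; rewrite adj_sym.
Qed.

Lemma sum_nonadj (f : G -> R) v :
  \sum_w (~~ adj v w && (w != v))%:R * f w =
  \sum_w f w - \sum_w (adj v w)%:R * f w - f v.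
Proof.
rewrite [X in _ - X](_ : _ = \sum_w (w == v)%:R * f w); last first.
  rewrite (bigD1 v) //= eqxx mul1r big1 ?addr0 // => w /negPf->.
  by rewrite mul0r.
rewrite -!sumrB; apply: eq_bigr => w _.
have [->|_] := eqVneq w v; first by rewrite adj_irrefl /=; ring.
by case: adj => /=; ring.
Qed.

Lemma deg_le v : (deg v)%:R <= #|G|%:R - 1 :> R.
Proof.
have : 0 <= \sum_w (~~ adj v w && (w != v))%:R * (1 : R).
  by apply: sumr_ge0 => w _; rewrite mulr1 ler0n.
rewrite sum_nonadj sumr_const (eq_bigr (fun w => (adj v w)%:R)); last first.
  by move=> w _; rewrite mulr1.
rewrite sum_adj; lra.
Qed.

(** A bound at each vertex is summed: both [d v ^+ 2] and the neighbour degree sum [t v] add up to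
    [zagreb1 G]. *)
Lemma de_caen (N := #|G|%:R - 1 : R) (S1 := \sum_(v : G) (deg v)%:R : R) :
    (forall v, 0 < deg v)%N ->
  2 * N * (zagreb1 G)%:R <= S1 ^+ 2 + N * (N - 1) * S1.
Proof.
move=> deg_gt0; pose d v : R := (deg v)%:R.
pose t v : R := \sum_w (adj v w)%:R * d w.
have local v : N * (d v ^+ 2 + t v) <= d v * (S1 + N * (N - 1)).
  have d_ge0 : 0 <= d v by apply: ler0n.
  have d_le : d v <= N := deg_le v.
  have t_le1 : t v <= N * d v.
    rewrite /t /d -sum_adj mulr_sumr; apply: ler_sum => w _.
    by rewrite mulrC; apply: ler_wpM2r; [apply: ler0n | apply: deg_le].
  (* Besides [t v], the sum [S1] contains [d v] and the degrees of the [N - d v] non-neighbours of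
     [v], each at least 1. *)
  have t_le2 : t v <= S1 - N.
    have : \sum_w (~~ adj v w && (w != v))%:R * (d w - 1) >= 0.
      apply: sumr_ge0 => w _; apply: mulr_ge0; first exact: ler0n.
      by rewrite subr_ge0 /d ler1n.
    rewrite sum_nonadj sumrB sumr_const.
    under [X in _ - X - _]eq_bigr => w _ do rewrite mulrBr mulr1.
    rewrite sumrB sum_adj -/(t v) -/(d v) -/S1 /N; lra.
  (* The bounds [t_le2] and [t_le1] get the weights [d v] and [N - d v], which sum to [N]. *)
  have := ler_wpM2r d_ge0 t_le2.
  have : t v * (N - d v) <= N * d v * (N - d v).
    by apply: ler_wpM2r t_le1; rewrite subr_ge0.
  rewrite expr2; lra.
have := ler_sum (index_enum G) (P := xpredT) (fun v _ => local v).
rewrite -mulr_sumr big_split /= -mulr_suml sum_adj_deg -zagreb1E -/S1 expr2.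
lra.
Qed.

End DegreeSums.

(** * The adjacency matrix *)

Section AdjacencyMatrix.
Variables (R : realType) (G : sgraph).
Local Notation A := (adjmx R G).

Definition row_fun (f : G -> R) : 'rV[R]_#|G| := \row_i f (enum_val i).

Lemma sum_enum_val (F : G -> R) : \sum_(i < #|G|) F (enum_val i) = \sum_v F v.
Proof. by rewrite -(big_enum_val (A := G)). Qed.

Lemma row_fun_sqnorm f : \sum_i row_fun f 0 i ^+ 2 = \sum_v f v ^+ 2.
Proof. by rewrite -sum_enum_val; apply: eq_bigr => i _; rewrite mxE. Qed.

Lemma row_fun_mul f :
  row_fun f *m A = row_fun (fun v => \sum_w (adj v w)%:R * f w).
Proof.
apply/rowP => i; rewrite !mxE -sum_enum_val; apply: eq_bigr => j _.
by rewrite !mxE mulrC adj_sym.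
Qed.

Lemma row_fun_form f :
  (row_fun f *m A *m (row_fun f)^T) 0 0 =
  \sum_v f v * \sum_w (adj v w)%:R * f w.
Proof.
rewrite row_fun_mul mxE -sum_enum_val; apply: eq_bigr => i _.
by rewrite !mxE mulrC.
Qed.

Lemma row_fun_lin a b f g :
  a *: row_fun f + b *: row_fun g = row_fun (fun v => a * f v + b * g v).
Proof. by apply/rowP => i; rewrite !mxE. Qed.

Lemma row_fun_eq0 f : row_fun f = 0 -> forall v, f v = 0.
Proof.
by move=> /rowP f0 v; have := f0 (enum_rank v); rewrite !mxE enum_rankK.
Qed.

(** Evaluates sums against the test vectors of [second_eigenvalue_ge]. *)
Lemma sum_indic4 (p q t r : G) (a b c : R) (g : G -> R) :
  \sum_v (a * ((v == p)%:R + (v == q)%:R) + b * ((v == t)%:R + c * (v == r)%:R))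
    * g v = a * (g p + g q) + b * (g t + c * g r).
Proof.
have one x : \sum_v (v == x)%:R * g v = g x.
  rewrite (bigD1 x) //= eqxx mul1r big1 ?addr0 // => v /negPf->.
  by rewrite mul0r.
transitivity (\sum_v (a * ((v == p)%:R * g v) + a * ((v == q)%:R * g v) +
    b * ((v == t)%:R * g v) + b * c * ((v == r)%:R * g v))).
  by apply: eq_bigr => v _; ring.
by rewrite !big_split /= -!mulr_sumr !one; ring.
Qed.

Hypothesis A_unit : nonsingular R G.

Lemma nonsingular_inj (f : G -> R) :
  (forall v : G, \sum_w (adj v w)%:R * f w = 0) -> forall v, f v = 0.
Proof.
move=> Af0; apply: row_fun_eq0; rewrite -[row_fun f](mulmxK A_unit) row_fun_mul.
by apply/rowP => j; rewrite !mxE big1 // => i _; rewrite mxE Af0 mul0r.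
Qed.

(** The indicator of an isolated vertex would lie in the kernel. *)
Lemma nonsingular_deg_gt0 (v : G) : (0 < deg v)%N.
Proof.
rewrite lt0n; apply/negP => /eqP deg0.
suff /nonsingular_inj/(_ v)/eqP : forall w : G,
    \sum_x (adj w x)%:R * (x == v)%:R = 0 :> R by rewrite eqxx oner_eq0.
move=> w; rewrite big1 // => x _; have [->|] := eqVneq x v; last by rewrite mulr0.
suff -> : adj w v = false by rewrite mul0r.
by move/eqP: deg0; rewrite cards_eq0 => /eqP/setP/(_ w); rewrite !inE adj_sym.
Qed.

(** For two vertices with the same neighbours, the difference of their indicators would lie in the
    kernel. *)
Lemma nonsingular_distinguish (u w : G) :
  u != w -> exists p, adj p u != adj p w.
Proof.
move=> u_neq_w; apply/existsP; apply: contraT => /existsPn same.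
suff /nonsingular_inj/(_ u)/eqP : forall x : G,
    \sum_y (adj x y)%:R * ((y == u)%:R - (y == w)%:R) = 0 :> R.
  by rewrite eqxx (negPf u_neq_w) subr0 oner_eq0.
move=> x; under eq_bigr => y _ do rewrite mulrBr.
have one z : \sum_y (adj x y)%:R * (y == z)%:R = (adj x z)%:R :> R.
  rewrite (bigD1 z) //= eqxx mulr1 big1 ?addr0 // => v /negPf->.
  by rewrite mulr0.
by rewrite sumrB !one; have /negPn/eqP-> := same x; rewrite subrr.
Qed.

(** Some [p] is adjacent to exactly one of [u] and [w]: that one is [q], the other is [r], and [t]
    is any neighbour of [r]. As [t] has 0, 1 or 2 neighbours among [p] and [q], the four vertices
    induce [2K_2], [P_4] or the paw. *)
Lemma nonsingular_edge_nonadjacent (u w : G) : u != w -> ~~ adj u w ->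
  exists p q r t : G, [/\ adj p q, ~~ adj r p, ~~ adj r q & adj t r].
Proof.
move=> u_neq_w nuw.
have nbr (x : G) : exists t, adj t x.
  have := nonsingular_deg_gt0 x; rewrite card_gt0 => /set0Pn[t].
  by rewrite inE adj_sym; exists t.
have [p] := nonsingular_distinguish u_neq_w.
have [tu tuP] := nbr u; have [tw twP] := nbr w.
case pu: (adj p u); case pw: (adj p w) => // _.
  by exists p, u, w, tw; rewrite (adj_sym w p) pw (adj_sym w u) nuw.
by exists p, w, u, tu; rewrite (adj_sym u p) pu nuw.
Qed.

End AdjacencyMatrix.

(** * The analytic inequality *)

(** The tangent bound for the exponential, rescaled to be an equality at [z = a]. *)
Lemma le_mul_expR (R : realType) (a z : R) :
  0 < a -> z <= a * expR (z / a - 1).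
Proof.
move=> a_gt0; rewrite mulrC -ler_pdivrMr //.
by apply: le_trans (expR_ge1Dx _); rewrite addrC subrK.
Qed.

(** Eight squarings, each rounded down, starting from [1 + 1 / 158 <= expR (1 / 158)]. *)
Lemma expR_gt5 (R : realType) : 5 < expR (128 / 79 : R).
Proof.
have dbl (a b u v : R) :
    0 <= a -> a <= expR u -> b <= a * a -> v = u + u -> b <= expR v.
  move=> a0 au ba ->; rewrite expRD; apply: le_trans ba _; exact: ler_pM.
have w0 : 159 / 158 <= expR (1 / 158 : R).
  by apply: le_trans (expR_ge1Dx _); lra.
have w1 : 718 / 709 <= expR (1 / 79 : R) by apply: dbl w0 _ _; lra.
have w2 : 281 / 274 <= expR (2 / 79 : R) by apply: dbl w1 _ _; lra.
have w3 : 813 / 773 <= expR (4 / 79 : R) by apply: dbl w2 _ _; lra.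
have w4 : 771 / 697 <= expR (8 / 79 : R) by apply: dbl w3 _ _; lra.
have w5 : 1078 / 881 <= expR (16 / 79 : R) by apply: dbl w4 _ _; lra.
have w6 : 1346 / 899 <= expR (32 / 79 : R) by apply: dbl w5 _ _; lra.
have w7 : 1948 / 869 <= expR (64 / 79 : R) by apply: dbl w6 _ _; lra.
apply: (@lt_le_trans _ _ (501 / 100)); first lra.
by apply: dbl w7 _ _; lra.
Qed.

Lemma expR_product_lt1 (R : realType) (t y : R) :
    0 < t -> 31 / 100 <= y ->
  t * (t + y) * expR (1 - y - t - 2 * y / (t + 2 * y)) < 1.
Proof.
move=> t_gt0 y_ge; have y_gt0 : 0 < y by lra.
set e := 1 - y - t - _.
(* [25 / 12] and [12 / 5] are close to [t] and [t + y] at the maximum for [y = 31 / 100]; their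
   product is the 5 of [expR_gt5]. *)
have bt := @le_mul_expR R (25 / 12) t ltac:(lra).
have by_ := @le_mul_expR R (12 / 5) (t + y) ltac:(lra).
set e1 := t / _ - 1 in bt; set e2 := (t + y) / _ - 1 in by_.
have e_le : e1 + e2 + e <= - (128 / 79).
  (* The fraction increases with [y]. *)
  have frac : 2 * y / (t + 2 * y) >= (62 / 100) / (t + 62 / 100).
    rewrite ler_pdivrMr; last lra.
    rewrite mulrAC ler_pdivlMr; last lra.
    have : 0 <= t * (y - 31 / 100) by apply: mulr_ge0; lra.
    lra.
  (* The slope [31 / 300] cancels the coefficient of [t] in the rest of [e1 + e2 + e]; the line runs
     just below the tangent near [t = 1829 / 1000]. *)
  have tangent : (62 / 100) / (t + 62 / 100) >=
      221 / 500 - (31 / 300) * t.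
    rewrite ler_pdivlMr; last lra.
    have := sqr_ge0 (t - 1829 / 1000); rewrite expr2; lra.
  rewrite /e /e1 /e2; lra.
apply: (@le_lt_trans _ _ (5 * expR (- (128 / 79)))).
  have -> : 5 * expR (- (128 / 79)) = 25 / 12 * (12 / 5) * expR (- (128 / 79)) :> R.
    by congr (_ * _); field.
  apply: (@le_trans _ _ (25 / 12 * expR e1 * (12 / 5 * expR e2) * expR e)).
    apply: ler_wpM2r; first exact: expR_ge0.
    by apply: ler_pM => //; lra.
  have -> : 25 / 12 * expR e1 * (12 / 5 * expR e2) * expR e =
      25 / 12 * (12 / 5) * expR (e1 + e2 + e) by rewrite !expRD; ring.
  apply: ler_wpM2l; first lra.
  by rewrite ler_expR.
by rewrite expRN ltr_pdivrMr ?expR_gt0 // mul1r expR_gt5.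
Qed.

Lemma spectral_bound_lt1 (R : realType) (N l t y S1 S2 : R) :
    1 <= N -> 0 < l -> 0 < t -> 31 / 100 <= y -> 0 < S1 ->
    S2 <= (l - t) * S1 + l * t * (N + 1) ->
    2 * N * S2 <= S1 ^+ 2 + N * (N - 1) * S1 ->
    l + y <= S2 / S1 ->
  l * t * y * expR (2 * (S2 / S1) - l - t - y - (N - 2)) < 1.
Proof.
move=> N_ge1 l_gt0 t_gt0 y_ge S1_gt0; have y_gt0 : 0 < y by lra.
set D := S2 / S1; have -> : S2 = D * S1 by rewrite divfK ?gt_eqF.
move=> quad deCaen y_le.
have {}deCaen : 2 * N * D <= S1 + N * (N - 1).
  by rewrite -(ler_pM2r S1_gt0); move: deCaen; rewrite expr2; lra.
pose x := D - l; have x_ge : y <= x by rewrite /x; lra.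
have x_gt0 : 0 < x by lra.
pose k := N - D.
have DE : D = N - k by rewrite /k; ring.
have lE : l = N - k - x by rewrite /x /k; ring.
pose c := t + 2 * x; have c_gt0 : 0 < c by rewrite /c; lra.
(* [S1] is eliminated: the spectral bound gives an upper estimate for it and de Caen's inequality a
   lower one. *)
have k_ge : x * ((N + 1) * (N + t)) <= k * (c * N - t).
  have h1 : S1 * (x + t) <= l * t * (N + 1) by rewrite /x; nra.
  have h2 : N * (2 * D - N + 1) * (x + t) <= S1 * (x + t).
    by apply: ler_wpM2r; [lra | nra].
  move: (le_trans h2 h1); rewrite lE DE /c; nra.
have den_gt0 : 0 < c * N - t by rewrite /c; nra.
(* Division of [(N + 1) * (N + t)] by [c * N - t] as polynomials in [N]: only the quotient is kept,
   the remainder being positive. *)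
have kc_ge : x * (c * (N + t + 1) + t) <= k * c ^+ 2.
  rewrite -(ler_pM2r den_gt0).
  apply: (@le_trans _ _ (x * ((N + 1) * (N + t)) * c ^+ 2)).
    rewrite -!mulrA; apply: ler_wpM2l; first lra.
    rewrite -subr_ge0.
    have -> : (N + 1) * ((N + t) * c ^+ 2) -
              (c * (N + t + 1) + t) * (c * N - t) =
              c * (c * t) + c * (t * (t + 1)) + t * t by ring.
    by rewrite !addr_ge0 // !mulr_ge0 //; lra.
  by rewrite [k * _ * _]mulrAC; apply: ler_wpM2r => //; apply: sqr_ge0.
(* With this choice of [a] the terms in [N] of the exponent are absorbed by [kc_ge], and the factor
   [(t + x) / x * y] is at most [t + y] because [y <= x]. *)
have l_le : l <= (t + x) / x * expR (l * x / (t + x) - 1).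
  have := @le_mul_expR R ((t + x) / x) l; rewrite invf_div mulrA; apply.
  by apply: divr_gt0; lra.
apply: le_lt_trans (expR_product_lt1 t_gt0 y_ge).
set E := _ - (N - 2); set e := l * x / (t + x) - 1 in l_le.
have eE_le : e + E <= 1 - y - t - 2 * y / (t + 2 * y).
  have mono : 2 * y / (t + 2 * y) <= 2 * x / c.
    rewrite ler_pdivrMr; last lra.
    rewrite mulrAC ler_pdivlMr // /c; nra.
  suff : l * x / (t + x) + 2 * x / c <= k - x.
    by rewrite /e /E /D -/D DE lE; lra.
  rewrite addf_div ?gt_eqF //; last lra.
  rewrite ler_pdivrMr; last by apply: mulr_gt0 => //; lra.
  rewrite -subr_ge0.
  have -> : (k - x) * ((t + x) * c) - (l * x * c + 2 * x * (t + x)) =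
            k * c ^+ 2 - x * (c * (N + t + 1) + t).
    by rewrite lE /c; ring.
  by rewrite subr_ge0.
apply: (@le_trans _ _ ((t + x) / x * expR e * (t * y) * expR E)).
  rewrite -[l * t * y]mulrA; apply: ler_wpM2r; first exact: expR_ge0.
  by apply: ler_wpM2r l_le; apply: mulr_ge0; lra.
have -> : (t + x) / x * expR e * (t * y) * expR E =
    t * ((t + x) / x * y) * expR (e + E) by rewrite (expRD e E); ring.
apply: ler_pM; rewrite ?expR_ge0 ?ler_expR //.
  by apply: mulr_ge0; [lra | apply: mulr_ge0; [apply: divr_ge0; lra | lra]].
apply: ler_wpM2l; first lra.
rewrite mulrAC ler_pdivrMr //; nra.
Qed.

(** * Energy *)

Lemma prod_norm_le_expR (R : realType) (s : seq R) :
  \prod_(x <- s) `|x| <= expR (\sum_(x <- s) (`|x| - 1)).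
Proof.
rewrite expR_sum; apply: ler_prod => x _; rewrite normr_ge0 /=.
by apply: le_trans (expR_ge1Dx _); rewrite addrC subrK.
Qed.

Lemma sorted_ends (R : realDomainType) (x y z : R) (s : seq R) :
    sorted >=%R [:: x, y & rcons s z] ->
  [/\ y <= x, all (<= y) (rcons s z), all (>= z) s & z <= y].
Proof.
rewrite sorted_pairwise; last by move=> a b c ab bc; apply: le_trans bc ab.
rewrite -!rcons_cons pairwise_rcons /= => /andP[].
move=> /and3P[_ zy zs] /andP[/andP[yx _] /andP[ys _]]; split=> //.
  by rewrite all_rcons; apply/andP; split.
Qed.

(** The remaining terms sum to [- (x + y)], so their absolute values sum to at least [x + y]. *)
Lemma sum_norm_ge (R : realDomainType) (x y : R) (s : seq R) :
    0 < x -> 0 < y -> x + (y + \sum_(z <- s) z) = 0 ->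
  2 * (x + y) <= x + (y + \sum_(z <- s) `|z|).
Proof.
move=> x_gt0 y_gt0 sum0.
have : 0 <= \sum_(z <- s) (`|z| + z).
  by apply: sumr_ge0 => z _; have := ler_norm (- z); rewrite normrN; lra.
by rewrite big_split /=; lra.
Qed.

Section Energy.
Variables (R : realType) (G : sgraph).
Local Notation A := (adjmx R G).
Local Notation s := (eigenvalues R G : seq R).

Lemma energyE : energy R G = \sum_(x <- s) `|x|.
Proof. by rewrite big_tuple. Qed.

Lemma eigenvalues_spectral : exists2 U : 'M[R]_#|G|, U *m U^T = 1%:M &
  A = U^T *m diag_mx (\row_i s`_i) *m U.
Proof.
apply: sym_spectral; rewrite ?size_tuple ?adjmx_sym //.
by have [] := eigenvaluesP R G.
Qed.

Lemma sum_eigenvalues : \sum_(x <- s) x = 0.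
Proof.
have [U UU AE] := eigenvalues_spectral.
rewrite (big_nth 0) size_tuple big_mkord -(spectral_trace UU AE).
by rewrite /mxtrace big1 // => i _; rewrite mxE adj_irrefl.
Qed.

(** The product is the absolute value of the determinant of an integer matrix, hence a positive
    integer. *)
Lemma prod_eigenvalues_ge1 :
  nonsingular R G -> 1 <= \prod_(x <- s) `|x|.
Proof.
have [U UU AE] := eigenvalues_spectral.
rewrite /nonsingular unitmxE unitfE => det_neq0.
rewrite -normr_prod (big_nth 0) size_tuple big_mkord -(spectral_det UU AE).
pose B : 'M[int]_#|G| := \matrix_(i, j) (adj (enum_val i) (enum_val j))%:R.
have AB : A = map_mx intr B by apply/matrixP => i j; rewrite !mxE rmorph_nat.
move: det_neq0; rewrite AB det_map_mx -intr_norm intr_eq0 -normr_gt0.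
by rewrite ler1z gtz0_ge1.
Qed.

(* For [e] edges between [t] and {p, q}, the vector equal to [a] on [p] and [q],
   [b] on [t] and [b / c] on [r], where [c = 31/100], satisfies
   [x A x^T - c |x|^2 = 2 (1 - c) a^2 + 2 e a b + (1 / c - c) b^2]; this is
   nonnegative for [e <= 2]. The constant is just below the second eigenvalue
   of the paw, the extremal case. *)
Lemma second_eigenvalue_ge (U : 'M[R]_#|G|) (i0 : 'I_#|G|) (m : R) (p q r t : G) :
    U *m U^T = 1%:M -> A = U^T *m diag_mx (\row_i s`_i) *m U ->
    (forall i : 'I_#|G|, i != i0 -> s`_i <= m) ->
    adj p q -> ~~ adj r p -> ~~ adj r q -> adj t r ->
  31 / 100 <= m.
Proof.
move=> UU AE s_le pq /negPf rp /negPf rq tr.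
have qp : adj q p by rewrite adj_sym.
have pr : adj p r = false by rewrite adj_sym.
have qr : adj q r = false by rewrite adj_sym.
have rt : adj r t by rewrite adj_sym.
have neq (x y z : G) : adj x z -> adj y z = false -> (x == y) = false.
  by move=> xz yz; apply: contraTF xz => /eqP->; rewrite yz.
have p_q := neq p q q pq (adj_irrefl q).
have t_r := neq t r r tr (adj_irrefl r).
have p_r := neq p r q pq rq; have q_r := neq q r p qp rp.
have t_p := neq t p r tr pr; have t_q := neq t q r tr qr.
pose f1 v : R := (v == p)%:R + (v == q)%:R.
pose f2 v : R := (v == t)%:R + 100 / 31 * (v == r)%:R.
apply: (courant_fischer_second UU AE (u1 := row_fun f1) (u2 := row_fun f2) s_le).
  move=> a b; rewrite row_fun_lin => /row_fun_eq0 h; split.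
    have := h p; rewrite /f1 /f2 eqxx p_q [p == t]eq_sym t_p p_r /=; lra.
  have := h t; rewrite /f1 /f2 eqxx t_p t_q t_r /=; lra.
move=> a b /=; rewrite row_fun_lin row_fun_sqnorm row_fun_form.
pose f v : R := a * f1 v + b * f2 v.
have gE v : \sum_w (adj v w)%:R * f w = a * ((adj v p)%:R + (adj v q)%:R) +
    b * ((adj v t)%:R + 100 / 31 * (adj v r)%:R).
  rewrite -(sum_indic4 p q t r a b (100 / 31) (fun w => (adj v w)%:R)).
  by apply: eq_bigr => w _; rewrite mulrC.
rewrite (eq_bigr (fun v => f v * f v)) => [|v _]; last by rewrite expr2.
rewrite !sum_indic4 !gE /f /f1 /f2 !eqxx !adj_irrefl pq qp rp rq pr qr tr rt.
rewrite p_q [q == p]eq_sym p_q t_r [r == t]eq_sym t_r p_r q_r t_p t_q.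
rewrite [r == p]eq_sym p_r [r == q]eq_sym q_r [p == t]eq_sym t_p.
rewrite [q == t]eq_sym t_q [adj p t]adj_sym [adj q t]adj_sym.
(* The first two squares complete the form when [t] has two neighbours, respectively one, in {p,
   q}. *)
have := sqr_ge0 (a + 100 / 69 * b); have := sqr_ge0 (a + 50 / 69 * b).
have := sqr_ge0 a; have := sqr_ge0 b; rewrite !expr2.
by case: (adj t p); case: (adj t q) => /=; lra.
Qed.

(** [spectral_interval] at the all-ones vector, whose image under [A] is the degree vector. *)
Lemma zagreb1_le_spectral (l t : R) :
    (forall x, x \in s -> - t <= x <= l) ->
  (zagreb1 G)%:R <=
    (l - t) * \sum_(v : G) (deg v)%:R + l * t * #|G|%:R.
Proof.
move=> s_itv; have [U UU AE] := eigenvalues_spectral.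
have s_itv' (i : 'I_#|G|) : - t <= s`_i <= l.
  by apply: s_itv; rewrite mem_nth // size_tuple.
have one (v : G) : \sum_w (adj v w)%:R * 1 = (deg v)%:R :> R.
  by rewrite -sum_adj; apply: eq_bigr => w _; rewrite mulr1.
pose v1 : 'rV[R]_#|G| := row_fun (fun=> 1).
have -> : (zagreb1 G)%:R = \sum_i (v1 *m A) 0 i ^+ 2 :> R.
  rewrite zagreb1E row_fun_mul row_fun_sqnorm.
  by apply: eq_bigr => v _; rewrite one.
have -> : \sum_(v : G) (deg v)%:R = (v1 *m A *m v1^T) 0 0 :> R.
  by rewrite row_fun_form; apply: eq_bigr => v _; rewrite one mul1r.
have -> : #|G|%:R = \sum_i v1 0 i ^+ 2 :> R.
  rewrite row_fun_sqnorm (eq_bigr (fun=> 1)) ?sumr_const // => v _.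
  exact: expr1n.
exact: (spectral_interval UU AE v1 s_itv').
Qed.

Lemma energy_gt_zagreb1 (u w : G) :
    nonsingular R G -> u != w -> ~~ adj u w ->
  (zagreb1 G)%:R / #|edges G|%:R < energy R G.
Proof.
move=> G_ns u_neq_w nuw; rewrite ltNge; apply/negP => E_le.
have [U UU AE] := eigenvalues_spectral.
have [p [q [r [t [pq nrp nrq tr]]]]] :=
  nonsingular_edge_nonadjacent G_ns u_neq_w nuw.
have n_gt0 : (0 < #|G|)%N by apply/card_gt0P; exists u.
have second_ge m : (forall i : 'I_#|G|, i != Ordinal n_gt0 -> s`_i <= m) ->
    31 / 100 <= m.
  by move=> s_le; apply: (second_eigenvalue_ge UU AE s_le pq nrp nrq tr).
pose S1 : R := \sum_(v : G) (deg v)%:R; pose S2 : R := (zagreb1 G)%:R.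
have S1_gt0 : 0 < S1.
  rewrite /S1 (bigD1 u) //= ltr_pwDl ?ltr0n ?(nonsingular_deg_gt0 G_ns) //.
  by apply: sumr_ge0 => v _; apply: ler0n.
have quad := zagreb1_le_spectral; rewrite -/S1 -/S2 in quad.
have caen : 2 * (#|G|%:R - 1) * S2 <= S1 ^+ 2 + (#|G|%:R - 1) * (#|G|%:R - 1 - 1) * S1.
  exact/de_caen/(nonsingular_deg_gt0 G_ns).
have {}E_le : energy R G <= 2 * (S2 / S1).
  apply: le_trans E_le _; rewrite /S1 -natr_sum sum_deg natrM -/S2.
  by rewrite invfM mulrCA [2 * _]mulrA mulfV ?pnatr_eq0 // mul1r.
have [s_sorted _] := eigenvaluesP R G.
have s_size : size s = #|G| by rewrite size_tuple.
have s_sum := sum_eigenvalues; have s_prod := prod_eigenvalues_ge1 G_ns.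
rewrite energyE in E_le.
move: quad second_ge s_sorted s_size s_sum s_prod E_le.
(* A single eigenvalue would be 0 by the trace, against the product bound; two would both be
   positive, against trace 0. Otherwise the list is [l], [y], [s'], [z], and [- z] plays the part of
   [t]. *)
case: (s : seq R) => [|l [|y s2]] quad second_ge s_sorted s_size.
- by have := n_gt0; rewrite -s_size.
- by rewrite !big_seq1 => ->; rewrite normr0 ler10.
case/lastP: s2 => [|s' z] in quad second_ge s_sorted s_size *.
  rewrite !big_cons !big_nil /= in s_sorted *; rewrite andbT in s_sorted.
  have : 31 / 100 <= y by apply: second_ge => -[[|[|i]] i_lt] //= _; rewrite -s_size in i_lt.
  lra.
have [yl ys zs zy] := sorted_ends s_sorted.
have y_ge : 31 / 100 <= y.
  apply: second_ge => -[[|i] i_lt] // _ /=.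
  rewrite -s_size /= !ltnS in i_lt.
  have : (y :: rcons s' z)`_i \in y :: rcons s' z by rewrite mem_nth.
  by rewrite inE => /predU1P[->|/(allP ys)].
have y_gt0 : 0 < y by apply: lt_le_trans y_ge; apply: divr_gt0.
have l_gt0 : 0 < l by apply: lt_le_trans yl.
rewrite !big_cons => s_sum s_prod E_le.
have abs_sum : 2 * (l + y) <= 2 * (S2 / S1).
  apply: le_trans E_le; rewrite (gtr0_norm l_gt0) (gtr0_norm y_gt0).
  exact: sum_norm_ge.
rewrite -!cats1 !big_cat !big_seq1 /= in s_sum s_prod E_le.
have z_lt0 : z < 0.
  rewrite ltNge; apply/negP => z_ge0.
  have : 0 <= \sum_(x <- s') x.
    rewrite big_seq; apply: sumr_ge0 => x xs; exact: le_trans (allP zs x xs).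
  by move: s_sum l_gt0 y_gt0 z_ge0; clear; lra.
have t_gt0 : 0 < - z by rewrite oppr_gt0.
have n_eq : #|G|%:R = (size s')%:R + 3 :> R.
  by rewrite -s_size /= size_rcons -natrD addn3.
have /quad {}quad : forall x, x \in [:: l, y & rcons s' z] -> - - z <= x <= l.
  have zl := le_trans zy yl.
  rewrite opprK => x; rewrite !inE mem_rcons inE.
  move=> /or4P[/eqP->|/eqP->|/eqP->|xs]; rewrite ?lexx ?zl ?zy ?yl //.
  rewrite (allP zs x xs) (le_trans _ yl) //.
  by apply: (allP ys); rewrite mem_rcons inE xs orbT.
(* Here [N] is [#|G| - 1], so [N - 2] is the number of eigenvalues in [s']. *)
have := @spectral_bound_lt1 R (#|G|%:R - 1) l (- z) y S1 S2.
rewrite subrK => /(_ _ l_gt0 t_gt0 y_ge S1_gt0 quad caen).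
have -> : 1 <= #|G|%:R - 1 :> R.
  by rewrite n_eq; have := ler0n R (size s'); clear; lra.
have -> : l + y <= S2 / S1 by rewrite -(ler_pM2l (ltr0Sn R 1)).
move=> /(_ isT isT); apply/negP; rewrite -leNgt; apply: le_trans s_prod _.
rewrite (gtr0_norm l_gt0) (gtr0_norm y_gt0) (ltr0_norm z_lt0).
have -> P : l * (y * (P * - z)) = l * - z * y * P by ring.
apply: ler_wpM2l; first by rewrite !mulr_ge0 // ltW.
apply: le_trans (prod_norm_le_expR _) _; rewrite ler_expR sumrB.
rewrite big_const_seq count_predT iter_addr_0.
move: E_le; rewrite (gtr0_norm l_gt0) (gtr0_norm y_gt0) (ltr0_norm z_lt0).
by rewrite n_eq; clear; lra.
Qed.

End Energy.

(** * Comparison of the two bounds, and the complete graph *)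

Section Complete.
Variables (R : realType) (G : sgraph).
Local Notation A := (adjmx R G).
Local Notation s := (eigenvalues R G : seq R).

Lemma isomorphic_complete :
  isomorphic G (complete #|G|) <-> forall u w : G, u != w -> adj u w.
Proof.
split=> [[f f_bij f_adj] u w u_neq_w | G_adj].
  by rewrite -f_adj /= (inj_eq (bij_inj f_bij)).
exists enum_rank; first exact: enum_rank_bij.
move=> x y; rewrite /= (inj_eq enum_rank_inj).
by have [->|/G_adj->] := eqVneq x y; rewrite ?adj_irrefl.
Qed.

(** One half of [M_1 / m] is kept; the other, [M_1 / (2m)], is at least [2m / n] by Cauchy-Schwarz
    for the degrees. *)
Lemma zagreb1_edges_ge :
  (zagreb1 G)%:R / (2 * #|edges G|%:R) + 2 * #|edges G|%:R / #|G|%:R <=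
  (zagreb1 G)%:R / #|edges G|%:R :> R.
Proof.
(* Without edges both sides are 0, as [x / 0 = 0]. *)
have [->|m_neq0] := eqVneq #|edges G| 0%N.
  by rewrite !mulr0 invr0 !mulr0 mul0r addr0.
pose S1 : R := \sum_(v : G) (deg v)%:R.
have S1E : S1 = 2 * #|edges G|%:R by rewrite /S1 -natr_sum sum_deg natrM.
have m_gt0 : 0 < #|edges G|%:R :> R by rewrite ltr0n lt0n.
have n_gt0 : 0 < #|G|%:R :> R.
  rewrite ltr0n lt0n; apply: contraNneq m_neq0 => /card0_eq G0.
  by apply/eqP/eq_card0 => e; apply/negbTE/negP => /imsetP[[u v]]; have := G0 u.
have cauchy : S1 ^+ 2 / #|G|%:R <= (zagreb1 G)%:R.
  rewrite -subr_ge0.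
  (* The defect in Cauchy-Schwarz is the sum of squared deviations from the mean degree. *)
  have -> : (zagreb1 G)%:R - S1 ^+ 2 / #|G|%:R =
      \sum_(v : G) ((deg v)%:R - S1 / #|G|%:R) ^+ 2.
    transitivity (\sum_(v : G) ((deg v)%:R ^+ 2 -
        (2 * (S1 / #|G|%:R) * (deg v)%:R - (S1 / #|G|%:R) ^+ 2))).
      rewrite sumrB -zagreb1E sumrB -mulr_sumr -/S1 sumr_const -mulr_natr.
      by field; rewrite gt_eqF.
    by apply: eq_bigr => v _; ring.
  by apply: sumr_ge0 => v _; apply: sqr_ge0.
have -> : (zagreb1 G)%:R / #|edges G|%:R =
    (zagreb1 G)%:R / (2 * #|edges G|%:R) + (zagreb1 G)%:R / (2 * #|edges G|%:R) :> R.
  by field; rewrite gt_eqF.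
rewrite lerD2l -S1E ler_pdivlMr ?S1E ?mulr_gt0 //.
by move: cauchy; rewrite S1E expr2 mulrAC.
Qed.

Hypothesis G_complete : forall u w : G, u != w -> adj u w.

Lemma complete_deg (v : G) : deg v = #|G|.-1.
Proof.
rewrite -(cardsC1 v); apply: eq_card => w; rewrite !inE.
by have [->|/G_complete] := eqVneq w v; rewrite ?adj_irrefl // adj_sym.
Qed.

(** Here [A = J - I] with [J] the all-ones matrix, and [J^2 = n J]. *)
Lemma complete_adjmx_sqr :
  A *m A = (#|G|%:R - 2) *: A + (#|G|%:R - 1)%:M.
Proof.
have AE : A = const_mx 1 - 1%:M :> 'M[R]_#|G|.
  apply/matrixP => i j; rewrite !mxE; have [->|i_neq_j] := eqVneq i j.
    by rewrite adj_irrefl subrr.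
  by rewrite G_complete ?subr0 // (inj_eq enum_val_inj).
have JJ : (const_mx 1 : 'M[R]_#|G|) *m const_mx 1 = const_mx #|G|%:R :> 'M[R]_#|G|.
  apply/matrixP => i j; rewrite !mxE (eq_bigr (fun=> 1)).
    by rewrite sumr_const card_ord.
  by move=> k _; rewrite !mxE mulr1.
rewrite AE mulmxBl mul1mx mulmxBr mulmx1 JJ; apply/matrixP => i j.
by rewrite !mxE; case: eqP => _; rewrite ?mulr1n ?mulr0n; ring.
Qed.

Lemma complete_energy : (0 < #|G|)%N -> energy R G = 2 * (#|G|%:R - 1).
Proof.
move=> n_gt0; have n_neq0 : #|G|%:R != 0 :> R by rewrite pnatr_eq0 -lt0n.
have [U UU AE] := eigenvalues_spectral R G.
(* The eigenvalues lie in {n - 1, -1}, where the absolute value agrees with an affine function;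
   trace 0 then gives the energy without counting multiplicities. *)
have abs_s x : x \in s ->
    `|x| = (#|G|%:R - 2) / #|G|%:R * x + 2 * (#|G|%:R - 1) / #|G|%:R.
  move=> /(nthP 0)[i]; rewrite size_tuple => i_lt <-.
  have := spectral_quadratic UU AE (Ordinal i_lt) complete_adjmx_sqr.
  move: (_`__) => z /= zE.
  have /eqP : (z - (#|G|%:R - 1)) * (z + 1) = 0 by move: zE; rewrite expr2; lra.
  rewrite mulf_eq0 => /orP[|]; rewrite ?subr_eq0 ?addr_eq0 => /eqP->.
    by rewrite ger0_norm ?subr_ge0 ?ler1n //; field.
  by rewrite normrN1; field.
rewrite energyE (eq_big_seq _ abs_s) big_split /= -mulr_sumr sum_eigenvalues.
rewrite mulr0 add0r big_const_seq count_predT iter_addr_0 size_tuple.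
by rewrite -[LHS]mulr_natr divfK.
Qed.

Lemma complete_zagreb1_energy :
  energy R G = (zagreb1 G)%:R / #|edges G|%:R /\
  energy R G = (zagreb1 G)%:R / (2 * #|edges G|%:R) + 2 * #|edges G|%:R / #|G|%:R.
Proof.
have m2 : 2 * #|edges G|%:R = #|G|%:R * #|G|.-1%:R :> R.
  rewrite -!natrM -sum_deg; congr _%:R.
  by rewrite (eq_bigr (fun=> #|G|.-1)) ?sum_nat_const // => v _; apply: complete_deg.
have zE : (zagreb1 G)%:R = #|G|%:R * #|G|.-1%:R ^+ 2 :> R.
  rewrite -natrX -natrM; congr _%:R.
  rewrite /zagreb1 (eq_bigr (fun=> #|G|.-1 ^ 2)%N) ?sum_nat_const // => v _.
  by rewrite complete_deg.
have mE : #|edges G|%:R = #|G|%:R * #|G|.-1%:R / 2 :> R by rewrite -m2; field.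
(* The cases [n = 0] and, below, [n = 1] are separate: there are no edges and every term is 0, as
   [x / 0 = 0]. *)
have [n0|n_gt0] := posnP #|G|.
  have s_nil : eigenvalues R G = [::] :> seq R by apply: size0nil; rewrite size_tuple.
  by rewrite zE mE n0 energyE s_nil big_nil !(mul0r, mulr0) addr0.
rewrite complete_energy // zE mE -subn1 natrB //.
have n_neq0 : #|G|%:R != 0 :> R by rewrite pnatr_eq0 -lt0n.
have [->|n1_neq0] := eqVneq (#|G|%:R : R) 1; first by rewrite subrr expr0n /= !(mulr0, mul0r, add0r).
by split; field; rewrite n_neq0 subr_eq0 n1_neq0.
Qed.

End Complete.

Theorem corollary9p1 (R : realType) (G : sgraph) (n m : nat)
    (order_G : #|G| = n) (size_G : #|edges G| = m)
    (nonsingular_G : nonsingular R G) :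
  [/\ energy R G >= (zagreb1 G)%:R / m%:R,
      energy R G >= (zagreb1 G)%:R / (2 * m%:R) + 2 * m%:R / n%:R,
      energy R G = (zagreb1 G)%:R / m%:R <-> isomorphic G (complete n)
    & energy R G = (zagreb1 G)%:R / (2 * m%:R) + 2 * m%:R / n%:R <->
        isomorphic G (complete n)].
Proof.
subst n m.
(* Either all distinct vertices are adjacent and both equalities hold, or a nonadjacent pair makes
   both inequalities strict. *)
have [/forallP G_complete|/forallPn[u /forallPn[w]]] :=
  boolP [forall u : G, forall w : G, (u != w) ==> adj u w].
  have {}G_complete (u w : G) : u != w -> adj u w.
    by move=> u_neq_w; have /forallP/(_ w)/implyP/(_ u_neq_w) := G_complete u.
  have [E1 E2] := complete_zagreb1_energy R G_complete.
  have iso := (isomorphic_complete G).2 G_complete.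
  by split; rewrite -?E1 -?E2.
rewrite negb_imply => /andP[u_neq_w nuw].
have lt1 := energy_gt_zagreb1 nonsingular_G u_neq_w nuw.
have lt2 := le_lt_trans (zagreb1_edges_ge R G) lt1.
have not_iso : ~ isomorphic G (complete #|G|).
  by move=> /isomorphic_complete/(_ u w u_neq_w); apply/negP.
split; rewrite ?ltW //; split=> // E_eq; [move: lt1 | move: lt2];
  by rewrite -E_eq ltxx.
Qed.
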